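(* Let $\Lambda$ be a $d$-dimensional lattice, let $\bm x,\bm y\in\mathbb R^d$, and let $\nu\in\mathbb C$ be such that $\nu\neq d$ if $\bm y\in\Lambda^*$. Then: (1) (Inversion symmetry) $Z_{\Lambda,\nu}(-\bm x,\bm y)=Z_{\Lambda,\nu}(\bm x,-\bm y)$ and $Z_{\Lambda,\nu}(-\bm x,-\bm y)=Z_{\Lambda,\nu}(\bm x,\bm y)$. (2) (Translation symmetry) For $\bm u\in\Lambda$ and $\bm v\in\Lambda^*$, $$Z_{\Lambda,\nu}(\bm x+\bm u,\bm y+\bm v)=e^{-2\pi i\bm y\cdot\bm u}\,Z_{\Lambda,\nu}(\bm x,\bm y).$$ (3) (Scale symmetry) For $s\in\mathbb R\setminus\{0\}$, $$Z_{\Lambda,\nu}(\bm x,\bm y)=|s|^\nu\,Z_{s\Lambda,\nu}(s\bm x,\bm y/s).$$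
   Context: A $d$-dimensional lattice is a set $\Lambda=A\mathbb Z^d$ with $A\in\mathbb R^{d\times d}$ regular; the reciprocal lattice is $\Lambda^*=A^{-T}\mathbb Z^d$. For $\bm x,\bm y\in\mathbb R^d$, the Epstein zeta function $Z_{\Lambda,\nu}(\bm x,\bm y)$ is the meromorphic continuation to $\nu\in\mathbb C$ of the lattice sum $\sum'_{\bm z\in\Lambda}e^{-2\pi i\bm y\cdot\bm z}/|\bm x-\bm z|^{\nu}$, $\mathrm{Re}(\nu)>d$, where the primed sum excludes the summand $\bm z=\bm x$ (if $\bm x\in\Lambda$). *)

(* Defs.v *)
From HB Require Import structures.
From mathcomp Require Import all_boot all_order all_algebra.
From mathcomp Require Import finmap complex.
From mathcomp Require Import all_classical all_reals all_analysis.
From mathcomp.analysis.showcase Require summability.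

Set Implicit Arguments.
Unset Strict Implicit.
Unset Printing Implicit Defensive.
Import Order.TTheory GRing.Theory Num.Theory.
Import numFieldNormedType.Exports.

Local Open Scope classical_set_scope.
Local Open Scope ring_scope.
Local Open Scope complex_scope.

Section Lattice.
Variables (R : realType) (d : nat).

Definition dot (u v : 'cV[R]_d) : R := \sum_(i < d) u i 0 * v i 0.

(* The library norm on matrices is the sup norm, hence this definition. *)
Definition enorm (u : 'cV[R]_d) : R := Num.sqrt (dot u u).

Definition lattice (A : 'M[R]_d) : set 'cV[R]_d :=
  [set A *m map_mx intr k | k in [set: 'cV[int]_d]].

(* Depends only on [lattice A] when [A] is invertible. *)
Definition reciprocal (A : 'M[R]_d) : set 'cV[R]_d := lattice (invmx A)^T.

Definition scale_set (s : R) (L : set 'cV[R]_d) : set 'cV[R]_d :=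
  [set s *: z | z in L].

End Lattice.

Section ComplexFunctions.
Variable R : realType.

Definition cexp (z : R[i]) : R[i] :=
  (expR (complex.Re z))%:C * (cos (complex.Im z) +i* sin (complex.Im z)).

(* [r ^ s] with the real logarithm, meant for [0 < r]. *)
Definition cpow (r : R) (s : R[i]) : R[i] := cexp (s * (ln r)%:C).

(* [R[i]^o] is [R[i]] with the topology of its norm. *)
Definition analytic_at (f : R[i] -> R[i]) (c : R[i]) : Prop :=
  exists a : nat -> R[i],
    \forall z \near (c : R[i]^o),
      [series a k * (z - c) ^+ k]_k @ \oo --> (f z : R[i]^o).

Definition pole_at (f : R[i] -> R[i]) (c : R[i]) : Prop :=
  exists (n : nat) (g : R[i] -> R[i]),
    [/\ (0 < n)%N, analytic_at g c, g c != 0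
      & \forall z \near (c : R[i]^o)^', f z = g z / (z - c) ^+ n].

(* Meromorphic functions on the plane as total functions: every point is
   either regular or a genuine pole, where the value is 0 by convention.
   In particular there are no unfilled removable singularities, so that a
   meromorphic continuation is unique as a total function. *)
Definition meromorphic (f : R[i] -> R[i]) : Prop :=
  forall c, analytic_at f c \/ (pole_at f c /\ f c = 0).

End ComplexFunctions.

Section Epstein.
Variables (R : realType) (d : nat).

Definition epstein_term (x y : 'cV[R]_d) (nu : R[i]) (z : 'cV[R]_d) : R[i] :=
  cexp (0 -i* (2 * pi * dot y z)) / cpow (enorm (x - z)) nu.

(* Unconditional convergence: limit of the finite partial sums along the
   directed set of finite subsets of [L] minus [x]. *)
Definition epstein_sum_cvg (L : set 'cV[R]_d) (x y : 'cV[R]_d)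
    (nu l : R[i]) : Prop :=
  summability.partial_sum
    (fun z : set_type (L `\ x) => epstein_term x y nu (val z))
    @ summability.totally --> (l : R[i]^o).

Definition epstein_continuation (L : set 'cV[R]_d) (x y : 'cV[R]_d)
    (f : R[i] -> R[i]) : Prop :=
  meromorphic f /\
  forall nu, d%:R < complex.Re nu -> epstein_sum_cvg L x y nu (f nu).

(* The default [fun=> 0] is a formality: the continuation exists for every
   lattice [L], by a classical theorem of Epstein. *)
Definition epstein_zeta (L : set 'cV[R]_d) (nu : R[i]) (x y : 'cV[R]_d) :
    R[i] :=
  xget (fun=> 0) [set f | epstein_continuation L x y f] nu.

End Epstein.

(* Main.v *)
Require Import Defs.
From HB Require Import structures.
From mathcomp Require Import all_boot all_order all_algebra.
From mathcomp Require Import finmap complex.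
From mathcomp Require Import all_classical all_reals all_analysis.
From mathcomp Require Import ring lra.
From mathcomp.analysis.showcase Require summability.

Set Implicit Arguments.
Unset Strict Implicit.
Unset Printing Implicit Defensive.

Import Order.TTheory GRing.Theory Num.Theory.
Import numFieldNormedType.Exports.

Local Open Scope classical_set_scope.
Local Open Scope ring_scope.
Local Open Scope complex_scope.

(* No meromorphic continuation has to be constructed: each symmetry turns a
   continuation for one lattice sum into one for the other, by reindexing the
   sum along a bijection of lattices and multiplying by an entire function
   without zeros.  Continuations are unique by the identity theorem, so the
   values agree if a continuation exists, and otherwise both sides are 0.
   Analyticity being defined by local power series, products are handled by
   Cauchy products of geometrically dominated series. *)

(** The symmetries are asserted at every exponent, poles included. This is possible because
    [meromorphic] fixes the value 0 at a pole, and a multiplier without zeros preserves both the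
    pole and that value. The inverse of the multiplier has to be analytic as well: continuations
    must pass in both directions, since otherwise one side of a symmetry could fall back to the
    default 0 while the other does not. The identity theorem runs along horizontal lines, each of
    which enters the half-plane of convergence, so that it rests on the connectedness of the real
    line. Poles met on the way are absorbed by comparing functions on neighbourhoods instead of at
    single points. *)

Local Notation normc := Normc.normc.

(** * Neighbourhoods and limits in the complex plane through a real-valued norm *)

Section ComplexNorm.
Variable R : realType.
Implicit Types (z w : R[i]) (u v : nat -> R[i]).

Lemma normc_normr z : `|z| = (normc z)%:C.
Proof. by case: z. Qed.

Lemma normc_ge0 z : 0 <= normc z.
Proof. by case: z => a b /=; exact: sqrtr_ge0. Qed.

Lemma normc_eq0 z : (normc z == 0) = (z == 0).
Proof.
apply/eqP/eqP => [/Normc.eq0_normc//|->]; exact: Normc.normc0.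
Qed.

Lemma normc_gt0 z : (0 < normc z) = (z != 0).
Proof. by rewrite lt0r normc_eq0 normc_ge0 andbT. Qed.

Lemma normc_opp z : normc (- z) = normc z.
Proof. exact: normcN. Qed.

Lemma normc_sub z w : normc (z - w) = normc (w - z).
Proof. by rewrite -normc_opp opprB. Qed.

Lemma normc_add z w : normc (z + w) <= normc z + normc w.
Proof. exact: le_normcD. Qed.

Lemma normc_triangle (v z w : R[i]) : normc (z - w) <= normc (z - v) + normc (v - w).
Proof. by rewrite -[z - w](subrKA v) normc_add. Qed.

Lemma normcX z n : normc (z ^+ n) = normc z ^+ n.
Proof.
elim: n => [|n IH]; first by rewrite !expr0 Normc.normc1.
by rewrite !exprS Normc.normcM IH.
Qed.

Lemma normcR (x : R) : normc x%:C = `|x|.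
Proof. by rewrite /= expr0n addr0 sqrtr_sqr. Qed.

Lemma normc_sum (I : Type) (r : seq I) (F : I -> R[i]) :
  normc (\sum_(i <- r) F i) <= \sum_(i <- r) normc (F i).
Proof.
elim/big_ind2 : _ => //; first by rewrite Normc.normc0.
by move=> x1 x2 y1 y2 h1 h2; apply: le_trans (normc_add _ _) (lerD h1 h2).
Qed.

(** The library norm of [R[i]] takes values in [R[i]], so radii are complex numbers. Positivity in
    the partial order forces a radius to be real, which allows a passage to real estimates. *)
Lemma nbhs_normc (c : R[i]) (P : R[i] -> Prop) :
  (\forall z \near (c : R[i]^o), P z) <->
  exists2 e : R, 0 < e & forall z, normc (z - c) < e -> P z.
Proof.
split.
  move=> /nbhs_ballP[e /= e0 H].
  exists (complex.Re e); first by move: e0; rewrite ltcE => /andP[].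
  move=> z zc; apply: H; rewrite /ball/= /ball_/=.
  rewrite -normrN opprB normc_normr.
  by move: e0; rewrite !ltcE /= => /andP[/eqP-> _]; rewrite eqxx.
case=> e e0 H; apply/nbhs_ballP; exists e%:C; first by rewrite /= ltcR.
by move=> z; rewrite /ball/= -normrN opprB => zc; apply: H; rewrite -ltcR -normc_normr.
Qed.

Lemma dnbhs_normc (c : R[i]) (P : R[i] -> Prop) :
  (\forall z \near (c : R[i]^o)^', P z) <->
  exists2 e : R, 0 < e & forall z, z != c -> normc (z - c) < e -> P z.
Proof.
split.
  move=> H; have [e e0 He] := (nbhs_normc c (fun z => z != c -> P z)).1 H.
  by exists e => // z zc ze; exact: He.
case=> e e0 He; apply: (nbhs_normc c (fun z => z != c -> P z)).2.
by exists e => // z ze zc; exact: He.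
Qed.

Lemma cvg_normc u (l : R[i]) :
  (u @ \oo --> (l : R[i]^o)) <->
  ((fun n => normc (u n - l)) @ \oo --> (0 : R)).
Proof.
split=> H.
  apply/cvgrPdist_lt => e e0; near=> n.
  rewrite sub0r normrN ger0_norm ?normc_ge0//; near: n.
  by apply: (H [set z | normc (z - l) < e]); apply/nbhs_normc; exists e.
move=> A /(nbhs_normc l A).1 [e e0 He].
have /cvgrPdist_lt/(_ e e0) := H; rewrite /nbhs/=; apply: filterS => n.
by rewrite sub0r normrN ger0_norm ?normc_ge0// => /He.
Unshelve. all: by end_near. Qed.

Lemma cvg_normcP u (l : R[i]) :
  (u @ \oo --> (l : R[i]^o)) <->
  (forall e : R, 0 < e -> \forall n \near \oo, normc (u n - l) < e).
Proof.
split=> [/cvg_normc/cvgrPdist_lt H e e0|H].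
  apply: filterS (H e e0) => n.
  by rewrite sub0r normrN ger0_norm ?normc_ge0.
apply/cvg_normc/cvgrPdist_lt => e e0; apply: filterS (H e e0) => n.
by rewrite sub0r normrN ger0_norm ?normc_ge0.
Qed.

Lemma squeeze_normc u (l : R[i]) (b : nat -> R) :
  (forall n, normc (u n - l) <= b n) -> b @ \oo --> (0 : R) ->
  u @ \oo --> (l : R[i]^o).
Proof.
move=> ub b0; apply/cvg_normc.
apply: (@squeeze_cvgr _ _ _ _ (fun=> 0) b) => //; last exact: cvg_cst.
by near=> n; rewrite normc_ge0 ub.
Unshelve. all: by end_near. Qed.

Lemma cvgc_cst (l : R[i]) : (fun=> l) @ \oo --> (l : R[i]^o).
Proof. exact: (@cvg_cst R[i]^o). Qed.

Lemma cvgcM u v (l m : R[i]) : u @ \oo --> (l : R[i]^o) ->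
  v @ \oo --> (m : R[i]^o) -> (fun n => u n * v n) @ \oo --> (l * m : R[i]^o).
Proof. exact: (@cvgZ R[i] R[i]^o). Qed.

Lemma cvgcB u v (l m : R[i]) : u @ \oo --> (l : R[i]^o) ->
  v @ \oo --> (m : R[i]^o) -> (fun n => u n - v n) @ \oo --> (l - m : R[i]^o).
Proof. exact: (@cvgB R[i] R[i]^o). Qed.

Lemma cvgc_unique u (l m : R[i]) : u @ \oo --> (l : R[i]^o) ->
  u @ \oo --> (m : R[i]^o) -> l = m.
Proof. exact: (@cvg_unique R[i]^o). Qed.

Lemma eq_cvgc (T : Type) (F : set_system T) (u v : T -> R[i]) (l : R[i]) :
  u =1 v -> u @ F --> (l : R[i]^o) -> v @ F --> (l : R[i]^o).
Proof. by move=> /funext->. Qed.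

Lemma cvgc_normc_le u (l m : R[i]) (k : R) : u @ \oo --> (l : R[i]^o) ->
  (\forall n \near \oo, normc (u n - m) <= k) -> normc (l - m) <= k.
Proof.
move=> /cvg_normcP ul uk; apply/ler_addgt0Pr => e e0.
near \oo => n.
have : normc (u n - l) < e by near: n; exact: ul.
have : normc (u n - m) <= k by near: n; exact: uk.
have := normc_triangle (u n) l m; rewrite [normc (l - u n)]normc_sub.
lra.
Unshelve. all: by end_near. Qed.

End ComplexNorm.

(** * Geometrically dominated series and their Cauchy products *)

Section Series.
Variable R : realType.
Implicit Types (z w : R[i]) (u v : nat -> R[i]).

Lemma seriesSc u n : series u n.+1 = series u n + u n.
Proof. by rewrite /series/= big_nat_recr. Qed.

Lemma series_normc_le u (M q : R) (m n : nat) :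
  0 <= q <= 1 / 2 -> (forall k, normc (u k) <= M * q ^+ k) -> (m <= n)%N ->
  normc (series u n - series u m) <= 2 * M * q ^+ m.
Proof.
move=> /andP[q0 q1] uM /subnKC <-.
have M0 : 0 <= M by have := uM 0%N; rewrite expr0 mulr1; exact: (le_trans (normc_ge0 _)).
(* The induction needs the sharper bound with the factor [1 - (1 / 2) ^+ (n - m)]: it leaves exactly
   the room for one more term, by [q ^+ k <= (1 / 2) ^+ k]. *)
suff : normc (series u (m + (n - m))%N - series u m)
    <= 2 * M * q ^+ m * (1 - (1 / 2) ^+ (n - m)%N).
  move=> /le_trans; apply; apply: ler_piMr.
    by rewrite !mulr_ge0// exprn_ge0.
  by rewrite lerBlDr lerDl exprn_ge0.
elim: (n - m)%N => [|k IH].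
  by rewrite addn0 subrr expr0 subrr mulr0 Normc.normc0.
rewrite addnS seriesSc addrAC; apply: le_trans (normc_add _ _) _.
have qk : q ^+ k <= (1 / 2) ^+ k by rewrite lerXn2r// nnegrE.
have qm : 0 <= M * q ^+ m by rewrite mulr_ge0// exprn_ge0.
have := uM (m + k)%N; rewrite exprD exprS mulrA.
have := ler_wpM2l qm qk.
have := IH; set A := (1 / 2) ^+ k; set B := M * q ^+ m.
rewrite -!(mulrA 2 M) -/B.
lra.
Qed.

Definition cauchy_product u v n : R[i] := \sum_(i < n.+1) u i * v (n - i)%N.

(** In this form, subtracting from [series u n * series v n] leaves the terms [u i] times a
    difference of partial sums of [v], to which the tail bound applies. *)
Lemma series_cauchy_product u v n :
  series (cauchy_product u v) n = \sum_(i < n) u i * series v (n - i)%N.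
Proof.
elim: n => [|n IH]; first by rewrite /series /= big_geq// big_ord0.
rewrite seriesSc IH /cauchy_product !big_ord_recr/= addrA.
rewrite -big_split/= subnn subSnn.
rewrite [series v 1](_ : _ = v 0%N); last by rewrite /series/= big_nat1.
congr (_ + _); apply: eq_bigr => i _.
by rewrite subSn ?seriesSc ?mulrDr// ltnW.
Qed.

(* The error after [n] terms is at most [2 M N n q ^ n], and [q <= 1 / 4]
   makes this at most [2 M N / 2 ^ n]. *)
Lemma cvg_cauchy_product u v (M N q : R) (U V : R[i]) :
  0 <= q <= 1 / 4 ->
  (forall k, normc (u k) <= M * q ^+ k) ->
  (forall k, normc (v k) <= N * q ^+ k) ->
  series u @ \oo --> (U : R[i]^o) -> series v @ \oo --> (V : R[i]^o) ->
  series (cauchy_product u v) @ \oo --> (U * V : R[i]^o).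
Proof.
move=> q01 uM vN uU vV; have /andP[q0 q1] := q01.
have M0 : 0 <= M by have := uM 0%N; rewrite expr0 mulr1; exact: (le_trans (normc_ge0 _)).
have N0 : 0 <= N by have := vN 0%N; rewrite expr0 mulr1; exact: (le_trans (normc_ge0 _)).
have d0 : (fun n => series u n * series v n - series (cauchy_product u v) n)
    @ \oo --> (0 : R[i]^o).
  apply: (@squeeze_normc _ _ _ (fun n => geometric (2 * M * N) (1 / 2) n)); last first.
    by apply: cvg_geometric; rewrite ger0_norm; lra.
  move=> n; rewrite subr0 series_cauchy_product [X in X * _]/series/=.
  rewrite big_mkord mulr_suml -sumrB.
  apply: (@le_trans _ _ (\sum_(i < n) (2 * M * N * q ^+ n))).
    apply: le_trans (normc_sum _ _) _; apply: ler_sum => i _.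
    rewrite -mulrBr Normc.normcM.
    have -> : 2 * M * N * q ^+ n = M * q ^+ i * (2 * N * q ^+ (n - i)).
      by rewrite -[in LHS](subnKC (ltnW (ltn_ord i))) exprD; ring.
    apply: ler_pM; rewrite ?normc_ge0//; apply: series_normc_le => //.
      by rewrite q0 (le_trans q1)//; lra.
    exact: leq_subr.
  rewrite sumr_const card_ord -[_ *+ n]mulr_natr -[X in X <= _]mulrA ler_wpM2l ?mulr_ge0//.
  have qn : q ^+ n <= (1 / 4) ^+ n by rewrite lerXn2r// nnegrE.
  apply: (le_trans (ler_wpM2r (ler0n _ n) qn)).
  (* The number [n] of terms is absorbed by [n <= 2 ^ n]. *)
  apply: (@le_trans _ _ ((1 / 4) ^+ n * 2 ^+ n)).
    apply: ler_wpM2l; first by rewrite exprn_ge0.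
    by rewrite -natrX ler_nat ltnW// ltn_expl.
  by rewrite -exprMn; rewrite (_ : 1 / 4 * 2 = 1 / 2 :> R) //; field.
have := cvgcB (cvgcM uU vV) d0; rewrite subr0.
by under eq_fun do rewrite subKr.
Qed.

Lemma cvg_series_near0 u (N : nat) : (forall k, (N <= k)%N -> u k = 0) ->
  series u @ \oo --> (series u N : R[i]^o).
Proof.
move=> u0; apply/cvg_normcP => e e0; exists N => // n /= Nn.
rewrite (_ : series u n = series u N) ?subrr ?Normc.normc0//.
rewrite -(subnKC Nn); elim: (n - N)%N => [|k IH]; first by rewrite addn0.
by rewrite addnS seriesSc IH u0 ?addr0// leq_addr.
Qed.

(** Each term is a difference of consecutive partial sums, and all of these stay within a fixed
    distance of [l]. *)
Lemma cvgc_series_bounded u (l : R[i]) : series u @ \oo --> (l : R[i]^o) ->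
  exists M : R, forall k, normc (u k) <= M.
Proof.
move=> /cvg_normc ul.
have /cvg_seq_bounded/pinfty_ex_gt0[K K0 HK] : cvgn (fun n => normc (series u n - l)).
  by apply/cvg_ex; exists 0.
have H n : normc (series u n - l) <= K.
  by apply: le_trans (HK n I); rewrite ler_norm.
exists (K + K) => k.
have -> : u k = series u k.+1 - series u k by rewrite seriesSc addrAC subrr add0r.
apply: le_trans (normc_triangle l _ _) _.
by rewrite [normc (l - _)]normc_sub lerD.
Qed.

End Series.

(** * Analytic functions: products, continuity and isolated zeros *)

Section Analytic.
Variable R : realType.
Implicit Types (z w c : R[i]) (f g : R[i] -> R[i]).

(** Convergence at the single point [c + e / 2] bounds the terms there. This is a Cauchy estimate on
    the coefficients and yields geometric domination on smaller discs. *)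
Lemma analytic_atP f c : analytic_at f c <->
  exists (a : nat -> R[i]) (M r : R), [/\ 0 < r,
    forall k, normc (a k) * r ^+ k <= M &
    forall z, normc (z - c) < r ->
      series (fun k => a k * (z - c) ^+ k) @ \oo --> (f z : R[i]^o)].
Proof.
split=> [[a /nbhs_normc[e e0 H]]|[a [M [r [r0 _ H]]]]]; last first.
  by exists a; apply/nbhs_normc; exists r.
have e2 : 0 < e / 2 by rewrite divr_gt0.
have zc : normc (c + (e / 2)%:C - c) = e / 2.
  by rewrite addrAC subrr add0r normcR gtr0_norm.
have [|M HM] := @cvgc_series_bounded R _ _ (H (c + (e / 2)%:C) _).
  by rewrite zc; lra.
exists a, M, (e / 2); split=> // [k|z ze]; last by apply: H; lra.
by rewrite -zc -normcX -Normc.normcM; exact: HM.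
Qed.

(** This quantitative form of continuity is the tail bound after one term ([m = 1]) with ratio
    [normc (z - c) / r]; halving the radius keeps the ratio at most 1/2. *)
Lemma analytic_lipschitz f c : analytic_at f c ->
  exists (K r : R), [/\ 0 <= K, 0 < r &
    forall z, normc (z - c) < r -> normc (f z - f c) <= K * normc (z - c)].
Proof.
move=> /analytic_atP[a [M [r [r0 aM H]]]].
have M0 : 0 <= M.
  by have := aM 0%N; rewrite expr0 mulr1; exact: le_trans (normc_ge0 _).
have fa z : normc (z - c) < r / 2 ->
    normc (f z - a 0%N) <= 2 * M / r * normc (z - c).
  move=> zr; apply: (cvgc_normc_le (H z _)); first by lra.
  exists 1%N => // n /= n1.
  have -> : a 0%N = series (fun k => a k * (z - c) ^+ k) 1%N.
    by rewrite /series/= big_nat1 expr0 mulr1.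
  have -> : 2 * M / r * normc (z - c) = 2 * M * (normc (z - c) / r) ^+ 1.
    by rewrite expr1; ring.
  apply: series_normc_le => // [|k].
    rewrite divr_ge0 ?normc_ge0 ?(ltW r0)//=.
    by rewrite ler_pdivrMr//; lra.
  rewrite Normc.normcM normcX expr_div_n mulrCA mulrC ler_wpM2l//.
    by rewrite exprn_ge0 ?normc_ge0.
  by rewrite ler_pdivlMr ?exprn_gt0.
have r2 : 0 < r / 2 by rewrite divr_gt0.
(* At [z = c] the bound just proved is 0. *)
have fc : f c = a 0%N.
  have := fa c; rewrite subrr Normc.normc0 mulr0 => /(_ r2).
  rewrite le_eqVlt ltNge normc_ge0 orbF normc_eq0 subr_eq0.
  by move/eqP.
exists (2 * M / r), (r / 2); split=> //; first by rewrite !mulr_ge0// invr_ge0 ltW.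
by move=> z zr; rewrite fc fa.
Qed.

Lemma analytic_cst (b c : R[i]) : analytic_at (fun=> b) c.
Proof.
exists (fun k => if k is 0%N then b else 0); apply/nbhs_normc; exists 1 => // z _.
set u := (X in series X).
have -> : b = series u 1%N by rewrite /series/= big_nat1 /u/= expr0 mulr1.
by apply: cvg_series_near0 => -[//|k] _; rewrite /u/= mul0r.
Qed.

Lemma analytic_subr c : analytic_at (fun z => z - c) c.
Proof.
exists (fun k => (k == 1)%N%:R); apply/nbhs_normc; exists 1 => // z _.
set u := (X in series X).
have -> : z - c = series u 2%N.
  by rewrite /series/= big_nat_recr//= big_nat1 /u/= mul0r mul1r add0r expr1.
by apply: cvg_series_near0 => -[//|[//|k]] _; rewrite /u/= mul0r.
Qed.

Lemma analyticB f g c : analytic_at f c -> analytic_at g c ->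
  analytic_at (fun z => f z - g z) c.
Proof.
move=> [a /nbhs_normc[r r0 Ha]] [b /nbhs_normc[s s0 Hb]].
exists (fun k => a k - b k); apply/nbhs_normc; exists (Num.min r s).
  by rewrite lt_min r0.
move=> z; rewrite lt_min => /andP[/Ha {}Ha /Hb {}Hb].
apply: eq_cvgc (cvgcB Ha Hb) => n.
by rewrite /series/= -sumrB; apply: eq_bigr => k _; rewrite mulrBl.
Qed.

Lemma analyticM f g c : analytic_at f c -> analytic_at g c ->
  analytic_at (fun z => f z * g z) c.
Proof.
move=> /analytic_atP[a [M [r [r0 aM Hf]]]] /analytic_atP[b [N [s [s0 bN Hg]]]].
exists (cauchy_product a b); apply/nbhs_normc.
(* Dividing by 4 makes the common ratio [normc (z - c) / t] at most 1/4, as [cvg_cauchy_product]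
   requires. *)
exists (Num.min r s / 4) => [|z]; first by rewrite divr_gt0// lt_min r0.
set t := Num.min r s => zt.
have t0 : 0 < t by rewrite lt_min r0.
have tr : t <= r by rewrite ge_min lexx.
have ts : t <= s by rewrite ge_min lexx orbT.
have dom (h : nat -> R[i]) (L l : R) : t <= l ->
    (forall k, normc (h k) * l ^+ k <= L) ->
    forall k, normc (h k * (z - c) ^+ k) <= L * (normc (z - c) / t) ^+ k.
  move=> tl hL k.
  rewrite Normc.normcM normcX expr_div_n mulrCA mulrC ler_wpM2l//.
    by rewrite exprn_ge0 ?normc_ge0.
  rewrite ler_pdivlMr ?exprn_gt0//; apply: le_trans (hL k).
  rewrite ler_wpM2l ?normc_ge0// lerXn2r// nnegrE ?ltW//.
  exact: lt_le_trans tl.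
have q01 : 0 <= normc (z - c) / t <= 1 / 4.
  rewrite divr_ge0 ?normc_ge0 ?(ltW t0)//=.
  by rewrite ler_pdivrMr//; lra.
have := cvg_cauchy_product q01 (dom _ _ _ tr aM) (dom _ _ _ ts bN).
move=> /(_ (f z) (g z)) H.
rewrite (_ : (fun k => _) =
  cauchy_product (fun k => a k * (z - c) ^+ k) (fun k => b k * (z - c) ^+ k)).
  by apply: H; [apply: Hf|apply: Hg]; lra.
apply/funext => n; rewrite /cauchy_product mulr_suml; apply: eq_bigr => i _.
have in' : (i <= n)%N by rewrite -ltnS.
have -> : (z - c) ^+ n = (z - c) ^+ i * (z - c) ^+ (n - i) by rewrite -exprD subnKC.
ring.
Qed.

Lemma analyticX c n : analytic_at (fun z => (z - c) ^+ n) c.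
Proof.
elim: n => [|n IH].
  by rewrite (_ : (fun _ => _) = fun=> 1); [exact: analytic_cst|apply/funext].
rewrite (_ : (fun _ => _) = fun z => (z - c) * (z - c) ^+ n).
  exact: analyticM (analytic_subr c) IH.
by apply/funext => z; rewrite exprS.
Qed.

Lemma analytic_eq_dnbhs f g c : analytic_at f c -> analytic_at g c ->
  (\forall z \near (c : R[i]^o)^', f z = g z) -> f c = g c.
Proof.
move=> /analytic_lipschitz[K [r [K0 r0 fK]]].
move=> /analytic_lipschitz[L [s [L0 s0 gL]]] /dnbhs_normc[e e0 fg].
apply/eqP; rewrite -subr_eq0 -normc_eq0 eq_le normc_ge0 andbT.
apply/ler_addgt0Pr => d d0; rewrite add0r.
(* A point at distance [t / 2] from [c] lies where both Lipschitz bounds and the equality hold, and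
   the total error is below [d]. The summand 1 keeps the denominator positive when [K] and [L]
   vanish. *)
pose t := Num.min (Num.min r s) (Num.min e (d / (K + L + 1))).
have KL1 : 0 < K + L + 1 by lra.
have t0 : 0 < t by rewrite !lt_min r0 s0 e0 divr_gt0.
pose z := c + (t / 2)%:C.
have zc : normc (z - c) = t / 2.
  by rewrite /z addrAC subrr add0r normcR gtr0_norm// divr_gt0.
have [tr ts te td] : [/\ t <= r, t <= s, t <= e & t <= d / (K + L + 1)].
  by rewrite /t !ge_min !lexx !orbT.
have zc0 : z != c by rewrite -subr_eq0 -normc_eq0 zc gt_eqF// divr_gt0.
have h1 : normc (f z - f c) <= K * (t / 2) by rewrite -zc; apply: fK; lra.
have h2 : normc (g z - g c) <= L * (t / 2) by rewrite -zc; apply: gL; lra.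
have h3 : f z = g z by apply: fg => //; lra.
have := normc_triangle (f z) (f c) (g c).
rewrite [normc (f c - f z)]normc_sub {2}h3.
move: td; rewrite ler_pdivlMr// => td.
have : (K + L) * t <= d by nra.
lra.
Qed.

(** If some coefficient is non-zero, let [m] be the first such index. Dividing by [(z - c) ^+ m]
    leaves an analytic [g] with [g c = a m], and continuity keeps [g] away from 0 near [c]. *)
Lemma analytic_isolated_zeros f c : analytic_at f c ->
  (\forall z \near (c : R[i]^o), f z = 0) \/
  (\forall z \near (c : R[i]^o)^', f z != 0).
Proof.
move=> /analytic_atP[a [M [r [r0 aM H]]]].
have [a0|] := pselect (forall k, a k = 0).
  left; apply/nbhs_normc; exists r => // z zr.
  apply: (cvgc_unique (H z zr)).
  rewrite (_ : (fun k => _) = fun=> 0); last by apply/funext => k; rewrite a0 mul0r.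
  have := @cvg_series_near0 R (fun=> 0) 0%N (fun _ _ => erefl).
  by rewrite [series _ 0%N]big_geq.
move=> /existsNP[k0 ak0]; right.
have exa : exists k, a k != 0 by exists k0; apply/eqP.
have [m am amin] : exists2 m, a m != 0 & forall k, (k < m)%N -> a k = 0.
  case: (ex_minnP exa) => m am mmin; exists m => // k km.
  by apply/eqP; apply: contraTT km => /mmin; rewrite -leqNgt.
have [g gc gE] : exists2 g, g c = a m &
    forall z, z != c -> g z = f z / (z - c) ^+ m.
  exists (fun z => if z == c then a m else f z / (z - c) ^+ m).
    by rewrite eqxx.
  by move=> z /negbTE ->.
have : analytic_at g c.
  exists (fun k => a (k + m)%N).
  apply/nbhs_normc; exists r; first exact: r0.
  move=> z zr.
  have [->|zc] := eqVneq z c.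
    rewrite gc.
    set u := (X in series X).
    have -> : a m = series u 1%N.
      by rewrite /series/= big_nat1 /u/= expr0 mulr1.
    by apply: cvg_series_near0 => -[//|k] _; rewrite /u/= subrr expr0n mulr0.
  rewrite (gE _ zc).
  have w0 : (z - c) ^+ m != 0 by rewrite expf_neq0// subr_eq0.
  (* The first [m] terms vanish, so the partial sum of length [n + m] divided by [(z - c) ^+ m] is
     the one of length [n] for the shifted coefficients. *)
  have /cvgcM : series (fun k => a k * (z - c) ^+ k) (n + m)%N @[n --> \oo]
      --> (f z : R[i]^o).
    exact: (cvg_comp _ _ (cvg_addnr m) (H z zr)).
  move=> /(_ _ _ (@cvgc_cst R ((z - c) ^- m))).
  apply: eq_cvgc => n; rewrite /series/=.
  rewrite addnC /index_iota !subn0 iotaD big_cat/= big1_seq ?add0r.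
    rewrite add0n -[X in iota X]addn0 iotaDl big_map mulr_suml.
    by apply: eq_bigr => k _; rewrite addnC exprD mulrA mulfK.
  move=> k /= ; rewrite mem_iota add0n => /andP[_ /amin ->]; exact: mul0r.
move=> /analytic_lipschitz[K [s [K0 s0 gK]]].
(* A zero within this radius would give [normc (a m) <= K * normc (z - c) < normc (a m)]. *)
apply/dnbhs_normc; exists (Num.min s (normc (a m) / (K + 1))).
  by rewrite lt_min s0 divr_gt0 ?normc_gt0//; lra.
move=> z zc; rewrite lt_min => /andP[zs]; rewrite ltr_pdivlMr; last by lra.
move=> zK; apply/eqP => fz0.
have := gK z zs; rewrite gc (gE _ zc) fz0 mul0r sub0r normc_opp.
have := normc_ge0 (z - c); nra.
Qed.

End Analytic.

(** * Meromorphic functions and the identity theorem *)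

Section Meromorphic.
Variable R : realType.
Implicit Types (z w c : R[i]) (f g h : R[i] -> R[i]).

(** This treats regular points and poles alike; a regular point gets the exponent 0. *)
Lemma meromorphic_quotient f c : meromorphic f ->
  exists (n : nat) g, analytic_at g c /\
    \forall z \near (c : R[i]^o)^', f z = g z / (z - c) ^+ n.
Proof.
move=> /(_ c)[fc|[[n [g [n0 gc _ fg]]] _]]; last by exists n, g.
exists 0%N, f; split=> //; apply/dnbhs_normc; exists 1 => // z _ _.
by rewrite expr0 divr1.
Qed.

(** After clearing the denominator, the numerator [h] agrees by continuity at [c] with a function
    that vanishes there, because the order [n] is positive; but [h c] is non-zero. *)
Lemma analytic_pole_dnbhs f g c : analytic_at f c -> pole_at g c ->
  ~ (\forall z \near (c : R[i]^o)^', f z = g z).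
Proof.
move=> fa [n [h [n0 ha hc /dnbhs_normc[e e0 gh]]]] /dnbhs_normc[d d0 fg].
suff : h c = (c - c) ^+ n * f c.
  by move/eqP; rewrite subrr expr0n gtn_eqF// mul0r (negbTE hc).
apply: (analytic_eq_dnbhs ha (analyticM (analyticX c n) fa)).
apply/dnbhs_normc; exists (Num.min e d); first by rewrite lt_min e0.
move=> z zc; rewrite lt_min => /andP[ze zd].
by rewrite fg// gh// mulrC divfK// expf_neq0// subr_eq0.
Qed.

(** A regular point cannot face a pole, two regular values agree by continuity, and two poles both
    carry the conventional value 0. *)
Lemma meromorphic_eq_dnbhs f g c : meromorphic f -> meromorphic g ->
  (\forall z \near (c : R[i]^o)^', f z = g z) ->
  \forall z \near (c : R[i]^o), f z = g z.
Proof.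
move=> fm gm fg.
suff fgc : f c = g c.
  have /dnbhs_normc[e e0 H] := fg; apply/nbhs_normc; exists e => // z ze.
  by have [->|zc] := eqVneq z c; [|exact: H].
have gf : \forall z \near (c : R[i]^o)^', g z = f z.
  have /dnbhs_normc[e e0 H] := fg; apply/dnbhs_normc; exists e => // z zc ze.
  by rewrite H.
have [fa|[fp fc]] := fm c; have [ga|[gp gc]] := gm c.
- exact: analytic_eq_dnbhs fg.
- by case: (analytic_pole_dnbhs fa gp fg).
- by case: (analytic_pole_dnbhs ga fp gf).
- by rewrite fc gc.
Qed.

(* The quotient representations at [c] give an analytic numerator for
   [f - g], whose zeros accumulate at [c]. *)
Lemma meromorphic_eq_limit f g c : meromorphic f -> meromorphic g ->
  (forall e : R, 0 < e -> exists2 w, normc (w - c) < e &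
     \forall z \near (w : R[i]^o), f z = g z) ->
  \forall z \near (c : R[i]^o), f z = g z.
Proof.
move=> fm gm H; apply: meromorphic_eq_dnbhs => //.
have [n [F [Fa /dnbhs_normc[r r0 fF]]]] := meromorphic_quotient c fm.
have [m [G [Ga /dnbhs_normc[s s0 gG]]]] := meromorphic_quotient c gm.
have FG z : z != c -> normc (z - c) < r -> normc (z - c) < s ->
    f z = g z <-> (z - c) ^+ m * F z - (z - c) ^+ n * G z = 0.
  move=> zc zr zs; rewrite fF// gG//.
  have wn k : (z - c) ^+ k != 0 by rewrite expf_neq0// subr_eq0.
  split=> [/eqP|/eqP].
    rewrite eqr_div// => /eqP FG; apply/eqP.
    by rewrite subr_eq0 mulrC FG mulrC.
  rewrite subr_eq0 => /eqP FG; apply/eqP; rewrite eqr_div//.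
  by rewrite mulrC FG mulrC.
have := analyticB (analyticM (analyticX c m) Fa) (analyticM (analyticX c n) Ga).
move=> /analytic_isolated_zeros[/nbhs_normc[e e0 He]|/dnbhs_normc[e e0 He]].
  apply/dnbhs_normc; exists (Num.min e (Num.min r s)).
    by rewrite !lt_min e0 r0.
  move=> z zc; rewrite !lt_min => /and3P[ze zr zs].
  by apply/FG => //; exact: He.
pose t := Num.min e (Num.min r s).
have t0 : 0 < t by rewrite !lt_min e0 r0.
have [te [tr ts]] : t <= e /\ t <= r /\ t <= s.
  by rewrite /t !ge_min !lexx !orbT.
have [w wt /nbhs_normc[d d0 fgd]] := H (t / 2) (divr_gt0 t0 (ltr0n _ 2)).
have [z zc [zw zt]] : exists2 z, z != c & normc (z - w) < d /\ normc (z - c) < t.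
  (* [FG] holds only away from [c]. If [w] is [c] itself, a point [c + q%:C] inside the disc of
     agreement replaces it. *)
  have [wc|wc] := eqVneq w c; last first.
    by exists w => //; rewrite subrr Normc.normc0; split=> //; lra.
  pose q := Num.min d t / 2.
  have q0 : 0 < q by rewrite divr_gt0// lt_min d0.
  have [qd qt] : q < d /\ q < t.
    have : Num.min d t <= d by rewrite ge_min lexx.
    have : Num.min d t <= t by rewrite ge_min lexx orbT.
    by rewrite /q; split; lra.
  have qc : normc (c + q%:C - c) = q.
    by rewrite addrAC subrr add0r normcR gtr0_norm.
  exists (c + q%:C); last by rewrite wc qc.
  by rewrite -subr_eq0 -normc_eq0 qc gt_eqF.
have zr : normc (z - c) < r by lra.
have zs : normc (z - c) < s by lra.
have ze : normc (z - c) < e by lra.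
by have := He z zc ze; rewrite (FG z zc zr zs).1 ?eqxx//; exact: fgd.
Qed.

(** [S] collects the real shifts of [c] near which [f] and [g] agree. It is open because agreement
    is on a neighbourhood, closed by [meromorphic_eq_limit], and non-empty; the shift 0 then gives
    the claim at [c]. *)
Lemma meromorphic_identity (b : R) f g : meromorphic f -> meromorphic g ->
  (forall z, b < complex.Re z -> f z = g z) -> f = g.
Proof.
move=> fm gm fg; apply/funext => c.
have ReB z :
    complex.Re (z - (c + (b + 1 - complex.Re c)%:C)) = complex.Re z - (b + 1).
  by case: z c => [? ?] [? ?] /=; rewrite addrCA subrr addr0.
pose S := [set t : R | \forall z \near ((c + t%:C : R[i]) : R[i]^o), f z = g z].
suff ST : S = setT.
  have : S 0 by rewrite ST.
  rewrite /S/= rmorph0 addr0 => /nbhs_normc[e e0]; apply.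
  by rewrite subrr Normc.normc0.
have distS (t u : R) : normc (c + t%:C - (c + u%:C)) = `|t - u|.
  by rewrite opprD addrACA subrr add0r -rmorphB normcR.
have openS : open S.
  rewrite openE => t /nbhs_normc[e e0 He]; rewrite /interior.
  apply/nbhs_ballP; exists (e / 2); first by rewrite /= divr_gt0.
  move=> u; rewrite /ball/= => tu; apply/nbhs_normc.
  exists (e / 2); first by rewrite divr_gt0.
  move=> z zu; apply: He.
  have := normc_triangle (c + u%:C) z (c + t%:C); rewrite distS distrC; lra.
have closedS : closed S.
  move=> t tS; apply: meromorphic_eq_limit => // e e0.
  have [u [Su tu]] := tS _ (nbhsx_ballx t e e0).
  exists (c + u%:C) => //; rewrite distS.
  by rewrite distrC.
have S0 : S !=set0.
  (* This shift moves [c] to real part [b + 1], so the unit disc around it lies in the half-plane of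
     agreement. *)
  exists (b + 1 - complex.Re c); apply/nbhs_normc; exists 1 => // z z1.
  apply: fg; have : `|complex.Re z - (b + 1)| < 1.
    apply: le_lt_trans z1; rewrite -lecR -normc_normr.
    by apply: le_trans (normc_ge_Re _); rewrite lecR ReB.
  by rewrite ltr_norml; lra.
have /(_ S S0) : connected [set: R] by apply/connected_intervalP.
by apply; exists S => //; rewrite setTI.
Qed.

End Meromorphic.

(** * Power series of the complex exponential, and entire multipliers *)

Section ComplexExponential.
Variable R : realType.
Implicit Types (z w c : R[i]) (f g h : R[i] -> R[i]).

Lemma cexpD z w : cexp (z + w) = cexp z * cexp w.
Proof.
case: z w => [a b] [x y]; rewrite /cexp /= expRD cosD sinD.
by simpc; congr (_ +i* _); ring.
Qed.

Lemma cexp0 : cexp (0 : R[i]) = 1.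
Proof. by rewrite /cexp /= expR0 cos0 sin0 mul1r. Qed.

Lemma cexp_neq0 z : cexp z != 0.
Proof.
apply/eqP => z0; have := cexpD z (- z).
by rewrite subrr cexp0 z0 mul0r => /eqP; rewrite oner_eq0.
Qed.

Lemma cexp_2pi_int (m : int) : cexp (0 -i* (2 * pi * m%:~R)) = 1 :> R[i].
Proof.
rewrite /cexp /= expR0 mul1r cosN sinN.
have -> : 2 * pi * m%:~R = 0 + (pi *+ 2) *~ m :> R.
  by rewrite add0r -[RHS]mulrzr [2 * pi]mulr_natl.
have cosz : cos (0 + (pi *+ 2) *~ m) = 1 :> R.
  case: m => n; first by rewrite -pmulrn (periodicn (@cosD2pi R)) cos0.
  by rewrite NegzE mulrNz add0r cosN -[X in cos X]add0r (periodicn (@cosD2pi R)) cos0.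
have sinz : sin (0 + (pi *+ 2) *~ m) = 0 :> R.
  case: m {cosz} => n; first by rewrite -pmulrn (periodicn (@sinD2pi R)) sin0.
  by rewrite NegzE mulrNz add0r sinN -[X in sin X]add0r (periodicn (@sinD2pi R)) sin0 oppr0.
by rewrite cosz sinz oppr0.
Qed.

Lemma series_complex (a b : nat -> R) n :
  series (fun k => a k +i* b k) n = series a n +i* series b n.
Proof.
elim: n => [|n IH]; first by rewrite /series/= !big_geq.
by rewrite seriesSc IH /series/= !big_nat_recr.
Qed.

Lemma cvg_complex (a b : nat -> R) (x y : R) : a @ \oo --> x -> b @ \oo --> y ->
  (fun n => a n +i* b n) @ \oo --> (x +i* y : R[i]^o).
Proof.
move=> ax bY.
apply: (@squeeze_normc _ _ _ (fun n => `|a n - x| + `|b n - y|)).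
  move=> n; have -> : (a n +i* b n) - (x +i* y) = (a n - x)%:C + 'i * (b n - y)%:C.
    by simpc; rewrite ?(mul0r, mul1r, add0r, addr0, sub0r, subr0, mulr0, oppr0).
  apply: le_trans (normc_add _ _) _; rewrite normcR lerD2l Normc.normcM normcR.
  by rewrite /= expr0n/= add0r expr1n sqrtr1 mul1r.
rewrite -[0]addr0; apply: cvgD.
  rewrite -(normr0 R) -(subrr x); apply: cvg_norm; apply: cvgB ax _; exact: cvg_cst.
rewrite -(normr0 R) -(subrr y); apply: cvg_norm; apply: cvgB bY _; exact: cvg_cst.
Qed.

Lemma expR_series (x : R) : series (fun k => (x ^+ k / k`!%:R)%:C) @ \oo -->
  ((expR x)%:C : R[i]^o).
Proof.
have e1 : series (exp_coeff x) @ \oo --> expR x.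
  exact: is_cvg_series_exp_coeff.
have c0 : (fun _ : nat => 0 : R) @ \oo --> (0 : R) by exact: cvg_cst.
apply: eq_cvgc (cvg_complex e1 c0) => n.
rewrite [RHS](series_complex _ (fun=> 0)); congr (_ +i* _).
by rewrite /series/= big1.
Qed.

Lemma expiR_series (x : R) : series (fun k => (0 +i* x) ^+ k / k`!%:R) @ \oo -->
  (cos x +i* sin x : R[i]^o).
Proof.
have c1 : series (cos_coeff x) @ \oo --> cos x.
  by rewrite unlock; exact: is_cvg_series_cos_coeff.
have s1 : series (sin_coeff x) @ \oo --> sin x.
  by rewrite unlock; exact: is_cvg_series_sin_coeff.
apply: eq_cvgc (cvg_complex c1 s1) => n.
rewrite -series_complex; congr (series _ n); apply/funext => k.
rewrite /cos_coeff/sin_coeff/=.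
rewrite [0 +i* x](_ : _ = 'i * x%:C); last first.
  by simpc; rewrite ?(mul0r, mul1r, add0r, addr0, sub0r, subr0, mulr0, oppr0).
rewrite exprMn.
rewrite -[RHS]mulrA.
have -> : x%:C ^+ k / k`!%:R = (x ^+ k / k`!%:R)%:C.
  by rewrite rmorphM rmorphXn fmorphV rmorph_nat.
have -> : ('i : R[i]) ^+ k = if odd k then (-1) ^+ k./2 * 'i else (-1) ^+ k./2.
  rewrite -{1}(odd_double_half k) exprD -mul2n exprM sqr_i mulrC.
  by case: odd; rewrite ?mulr1.
have -> j : (-1) ^+ j = ((-1) ^+ j)%:C :> R[i] by rewrite rmorphXn rmorphN1.
(* [sin_coeff] carries the sign exponent [k.-1./2], whereas the power of ['i] produces [k./2]. *)
have oddk : odd k -> k.-1./2 = k./2.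
  by move=> ok; rewrite -{1}(odd_double_half k) ok /= doubleK.
rewrite -exprnP; case: ifPn => [ok|_].
  rewrite oddk//.
  by apply/eqP; rewrite eq_complex; apply/andP; split; apply/eqP; rewrite /=; ring.
by apply/eqP; rewrite eq_complex; apply/andP; split; apply/eqP; rewrite /=; ring.
Qed.

(** [cexp] is a product of a real exponential and a point of the unit circle. Their series are both
    dominated by the powers of [normc w], and the binomial theorem identifies the Cauchy product;
    the bound 1/4 comes from [cvg_cauchy_product]. *)
Lemma cexp_series w : normc w <= 1 / 4 ->
  series (fun k => w ^+ k / k`!%:R) @ \oo --> (cexp w : R[i]^o).
Proof.
case: w => a b; set w := _ +i* _ => w4.
have q01 : 0 <= normc w <= 1 / 4 by rewrite normc_ge0.
have dom (z : R[i]) : normc z <= normc w ->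
    forall k, normc (z ^+ k / k`!%:R) <= 1 * normc w ^+ k.
  move=> zw k; rewrite mul1r Normc.normcM normcX Normc.normcV.
  have -> : normc (k`!%:R : R[i]) = k`!%:R.
    by rewrite -(rmorph_nat (real_complex R)) normcR ger0_norm.
  apply: (@le_trans _ _ (normc z ^+ k)).
    rewrite ler_piMr ?exprn_ge0 ?normc_ge0// invf_le1 ?ltr0n ?fact_gt0//.
    by rewrite ler1n fact_gt0.
  by rewrite lerXn2r// nnegrE normc_ge0.
have wa : normc (a%:C) <= normc w.
  by rewrite /= expr0n/= addr0 ler_sqrt ?addr_ge0 ?sqr_ge0// lerDl sqr_ge0.
have wb : normc (0 +i* b) <= normc w.
  by rewrite /= expr0n/= add0r ler_sqrt ?addr_ge0 ?sqr_ge0// lerDr sqr_ge0.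
have ea : series (fun k => a%:C ^+ k / k`!%:R) @ \oo --> ((expR a)%:C : R[i]^o).
  have := @expR_series a; apply: eq_cvgc => n; congr (series _ n); apply/funext => k.
  by rewrite rmorphM rmorphXn fmorphV rmorph_nat.
have := cvg_cauchy_product q01 (dom _ wa) (dom _ wb) ea (@expiR_series b).
rewrite /cexp/=; apply: eq_cvgc => n; congr (series _ n); apply/funext => k.
(* With the real part second, [exprDn] puts the index [i] on [a%:C], matching [cauchy_product]. *)
have -> : w = 0 +i* b + a%:C.
  by rewrite /w; simpc; rewrite ?(mul0r, mul1r, add0r, addr0, sub0r, subr0, mulr0, oppr0).
rewrite exprDn mulr_suml; apply: eq_bigr => i _.
have ik : (i <= k)%N by rewrite -ltnS.
have f0 j : (j`!%:R : R[i]) != 0 by rewrite pnatr_eq0 -lt0n fact_gt0.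
rewrite -mulr_natr -(bin_fact ik) !natrM.
by field; rewrite !f0 pnatr_eq0 -lt0n bin_gt0.
Qed.

Lemma cpow_neq0 (r : R) z : cpow r z != 0.
Proof. exact: cexp_neq0. Qed.

Lemma analytic_cpow (r : R) c : analytic_at (cpow r) c.
Proof.
exists (fun k => cpow r c * ((ln r)%:C ^+ k / k`!%:R)); apply/nbhs_normc.
have L0 : 0 < 4 * (`|ln r| + 1) by rewrite mulr_gt0// ltr_wpDl.
(* This radius keeps [(z - c) * ln r] within the bound 1/4 of [cexp_series]; the summand 1 covers
   [ln r = 0]. *)
exists (4 * (`|ln r| + 1))^-1; first by rewrite invr_gt0.
move=> z zc.
have wz : normc ((z - c) * (ln r)%:C) <= 1 / 4.
  rewrite Normc.normcM normcR.
  move: zc; rewrite -div1r ltr_pdivlMr// => zc.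
  have := normc_ge0 (z - c); have := normr_ge0 (ln r); nra.
have -> : cpow r z = cpow r c * cexp ((z - c) * (ln r)%:C).
  by rewrite /cpow -cexpD -mulrDl addrC subrK.
apply: eq_cvgc (cvgcM (@cvgc_cst R (cpow r c)) (cexp_series wz)) => n.
rewrite /series/= mulr_sumr; apply: eq_bigr => k _.
by rewrite exprMn; ring.
Qed.

(** As [h] has no zeros, the numerator at a pole stays non-zero, so a pole keeps its order, and the
    product keeps the value 0 there. *)
Lemma meromorphicM h f : (forall c, analytic_at h c) -> (forall c, h c != 0) ->
  meromorphic f -> meromorphic (fun z => h z * f z).
Proof.
move=> ha h0 fm c; have [fa|[[n [g [n0 ga gc /dnbhs_normc[e e0 fg]]]] fc]] := fm c.
  by left; exact: (analyticM (ha c) fa).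
right; split; last by rewrite fc mulr0.
exists n, (fun z => h z * g z); split.
- exact: n0.
- exact: (analyticM (ha c) ga).
- by rewrite mulf_neq0.
- by apply/dnbhs_normc; exists e => // z zc ze; rewrite fg// mulrA.
Qed.

End ComplexExponential.

(** * Reindexing of unconditional sums *)

Section UnconditionalSums.
Variables (R : realType) (V : choiceType).

Lemma cvg_partial_sum_reindex (D E : set V) (phi psi : V -> V)
    (F G : V -> R[i]) (c l : R[i]) :
  cancel phi psi -> cancel psi phi ->
  (forall z, D z -> E (phi z)) -> (forall z, E z -> D (psi z)) ->
  (forall z, E z -> G z = c * F (psi z)) ->
  summability.partial_sum (fun z : set_type D => F (val z))
    @ summability.totally --> (l : R[i]^o) ->
  summability.partial_sum (fun z : set_type E => G (val z))
    @ summability.totally --> (c * l : R[i]^o).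
Proof.
move=> phiK psiK DE ED GF Fl.
pose p (w : set_type E) : set_type D := SigSub (mem_set (ED _ (set_valP w))).
pose q (w : set_type D) : set_type E := SigSub (mem_set (DE _ (set_valP w))).
have pq w : p (q w) = w by apply: val_inj; rewrite /= phiK.
have qp w : q (p w) = w by apply: val_inj; rewrite /= psiK.
have sumE B : summability.partial_sum (fun z : set_type E => G (val z)) B =
    c * summability.partial_sum (fun z : set_type D => F (val z))
          [fset p w | w in B]%fset.
  rewrite /summability.partial_sum.
  rewrite -(big_seq_fsetE _ _ xpredT (fun z : set_type E => G (val z))).
  rewrite -(big_seq_fsetE _ _ xpredT (fun z : set_type D => F (val z))) /=.
  rewrite big_imfset/=; last by move=> ? ? _ _; exact: (can_inj qp).
  by rewrite mulr_sumr; apply: eq_bigr => w _; rewrite GF//; exact: set_valP.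
(* The image of [B] under [p] contains a given finite set [A] as soon as [B] contains the image of
   [A] under [q]. *)
have pB : (fun B : {fset set_type E} => [fset p w | w in B]%fset) @ summability.totally -->
    summability.totally.
  move=> S [A _ AS]; exists [fset q w | w in A]%fset => // B /= qB.
  apply: AS => /=; apply/fsubsetP => w wA; apply/imfsetP; exists (q w) => //=.
  by apply: (fsubsetP qB); apply/imfsetP; exists w.
have := cvg_comp _ _ pB Fl => {}Fl.
have tF := @summability.totally_filter (set_type E).
have cFl := @cvgZ R[i] R[i]^o _ _ _ _ _ c l (@cvg_cst _ _ _ _ _) Fl.
by refine (eq_cvgc _ (cFl _ _)) => B; rewrite sumE.
Qed.

End UnconditionalSums.

(** * Transport of continuations between lattice sums *)

Section EpsteinTransport.
Variables (R : realType) (d : nat).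
Implicit Types (L : set 'cV[R]_d) (x y z u v : 'cV[R]_d) (h : R[i] -> R[i]).

Lemma epstein_continuation_unique L x y f g :
  epstein_continuation L x y f -> epstein_continuation L x y g -> f = g.
Proof.
move=> [fm fs] [gm gs]; apply: (meromorphic_identity (b := d%:R)) fm gm _.
move=> nu dnu; have tF := @summability.totally_filter (set_type (L `\ x)).
exact: (@cvg_unique R[i]^o (@norm_hausdorff _ _) _ _ _ _ (fs nu dnu) (gs nu dnu)).
Qed.

Lemma epstein_continuation_transport L L' x x' y y' h
    (phi psi : 'cV[R]_d -> 'cV[R]_d) f :
  (forall c, analytic_at h c) -> (forall c, h c != 0) ->
  cancel phi psi -> cancel psi phi ->
  (forall z, (L `\ x) z -> (L' `\ x') (phi z)) ->
  (forall z, (L' `\ x') z -> (L `\ x) (psi z)) ->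
  (forall nu z, (L' `\ x') z ->
     epstein_term x' y' nu z = h nu * epstein_term x y nu (psi z)) ->
  epstein_continuation L x y f ->
  epstein_continuation L' x' y' (fun nu => h nu * f nu).
Proof.
move=> ha h0 phiK psiK LL' L'L term [fm fs]; split; first exact: meromorphicM.
move=> nu /fs; apply: (cvg_partial_sum_reindex phiK psiK LL' L'L) => z.
exact: term.
Qed.

(** [h'] is the inverse of [h] and transports continuations back. A continuation thus exists for
    both sums or for neither, which rules out the mixed cases of the two [xget] choices. *)
Lemma epstein_zeta_transport L L' x x' y y' h h'
    (phi psi : 'cV[R]_d -> 'cV[R]_d) nu :
  (forall c, analytic_at h c) -> (forall c, analytic_at h' c) ->
  (forall c, h c * h' c = 1) ->
  cancel phi psi -> cancel psi phi ->
  (forall z, (L `\ x) z -> (L' `\ x') (phi z)) ->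
  (forall z, (L' `\ x') z -> (L `\ x) (psi z)) ->
  (forall nu z, (L' `\ x') z ->
     epstein_term x' y' nu z = h nu * epstein_term x y nu (psi z)) ->
  epstein_zeta L' nu x' y' = h nu * epstein_zeta L nu x y.
Proof.
move=> ha h'a hh' phiK psiK LL' L'L term.
have h0 c : h c != 0.
  by apply/eqP => hc; have /eqP := hh' c; rewrite hc mul0r eq_sym oner_eq0.
have h'0 c : h' c != 0.
  by apply/eqP => hc; have /eqP := hh' c; rewrite hc mulr0 eq_sym oner_eq0.
have term' nu' z : (L `\ x) z ->
    epstein_term x y nu' z = h' nu' * epstein_term x' y' nu' (phi z).
  by move=> /LL' /term ->; rewrite phiK mulrA [h' _ * _]mulrC hh' mul1r.
rewrite /epstein_zeta; case: xgetP => [g _ g'|noL'].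
  case: xgetP => [f _ fL|noL].
    have := epstein_continuation_transport ha h0 phiK psiK LL' L'L term fL.
    by move=> /(epstein_continuation_unique g') ->.
  by case: (noL _ (epstein_continuation_transport h'a h'0 psiK phiK L'L LL' term' g')).
case: xgetP => [f _ fL|_]; last by rewrite mulr0.
by case: (noL' _ (epstein_continuation_transport ha h0 phiK psiK LL' L'L term fL)).
Qed.

(** * Scalar products, Euclidean norms and lattices *)

Lemma dotDl u v z : dot (u + v) z = dot u z + dot v z.
Proof. by rewrite /dot -big_split; apply: eq_bigr => i _; rewrite mxE mulrDl. Qed.

Lemma dotDr u v z : dot z (u + v) = dot z u + dot z v.
Proof. by rewrite /dot -big_split; apply: eq_bigr => i _; rewrite mxE mulrDr. Qed.

Lemma dotZl (s : R) u v : dot (s *: u) v = s * dot u v.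
Proof. by rewrite /dot mulr_sumr; apply: eq_bigr => i _; rewrite mxE mulrA. Qed.

Lemma dotZr (s : R) u v : dot u (s *: v) = s * dot u v.
Proof. by rewrite /dot mulr_sumr; apply: eq_bigr => i _; rewrite mxE mulrCA. Qed.

Lemma dotNl u v : dot (- u) v = - dot u v.
Proof. by rewrite -scaleN1r dotZl mulN1r. Qed.

Lemma dotNr u v : dot u (- v) = - dot u v.
Proof. by rewrite -scaleN1r dotZr mulN1r. Qed.

Lemma enormZ (s : R) u : enorm (s *: u) = `|s| * enorm u.
Proof.
by rewrite /enorm dotZl dotZr mulrA -expr2 sqrtrM ?sqr_ge0// sqrtr_sqr.
Qed.

Lemma enormN u : enorm (- u) = enorm u.
Proof. by rewrite -scaleN1r enormZ normrN1 mul1r. Qed.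

Lemma enorm_gt0 u : u != 0 -> 0 < enorm u.
Proof.
move=> u0; rewrite sqrtr_gt0 lt0r sumr_ge0 ?andbT => [|i _]; last exact: sqr_ge0.
apply: contra_neq u0 => /eqP; rewrite psumr_eq0 => [|i _]; last exact: sqr_ge0.
move=> /allP H; apply/colP => i; rewrite mxE.
by have := H i (mem_index_enum i); rewrite /= -expr2 sqrf_eq0 => /eqP.
Qed.

Lemma cpowMl (r s : R) nu : 0 < r -> 0 < s ->
  cpow (r * s) nu = cpow r nu * cpow s nu.
Proof. by move=> r0 s0; rewrite /cpow lnM// rmorphD mulrDr cexpD. Qed.

Lemma latticeD (A : 'M[R]_d) u v :
  lattice A u -> lattice A v -> lattice A (u + v).
Proof.
move=> [k _ <-] [l _ <-]; exists (k + l) => //.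
by rewrite -mulmxDr; congr (_ *m _); apply/matrixP => i j; rewrite !mxE rmorphD.
Qed.

Lemma latticeN (A : 'M[R]_d) u : lattice A u -> lattice A (- u).
Proof.
move=> [k _ <-]; exists (- k) => //.
by rewrite -mulmxN; congr (_ *m _); apply/matrixP => i j; rewrite !mxE rmorphN.
Qed.

(** The matrices cancel in the product of the transpose of [v] with [u], leaving the scalar product
    of the two integer coordinate vectors. *)
Lemma dot_reciprocal_lattice (A : 'M[R]_d) u v : A \in unitmx ->
  lattice A u -> reciprocal A v -> exists m : int, dot v u = m%:~R.
Proof.
move=> Aunit [k _ <-] [l _ <-]; exists ((l^T *m k) 0 0).
have dotE a b : dot a b = (a^T *m b : 'M[R]_1) 0 0.
  by rewrite mxE; apply: eq_bigr => i _; rewrite mxE.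
rewrite dotE trmx_mul trmxK -mulmxA mulKmx// !mxE rmorph_sum.
by apply: eq_bigr => i _; rewrite !mxE rmorphM.
Qed.

(** * The three symmetries as instances of the transport *)

Lemma epstein_zeta_opp (A : 'M[R]_d) x y nu :
  epstein_zeta (lattice A) nu (- x) y = epstein_zeta (lattice A) nu x (- y).
Proof.
have opp z w : (lattice A `\ w) z -> (lattice A `\ - w) (- z).
  by move=> [Lz zw]; split; [exact: latticeN|move=> /oppr_inj].
rewrite -[RHS]mul1r.
apply: (@epstein_zeta_transport _ _ _ _ _ _ (fun=> 1) (fun=> 1) -%R -%R).
- by move=> c; exact: analytic_cst.
- by move=> c; exact: analytic_cst.
- by move=> _; rewrite mulr1.
- exact: opprK.
- exact: opprK.
- by move=> z; exact: opp.
- by move=> z /opp; rewrite opprK.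
- move=> nu' z _; rewrite mul1r /epstein_term dotNl dotNr opprK.
  by rewrite -[in RHS]enormN opprD !opprK.
Qed.

Lemma epstein_zeta_translate (A : 'M[R]_d) x y u v nu : A \in unitmx ->
  lattice A u -> reciprocal A v ->
  epstein_zeta (lattice A) nu (x + u) (y + v)
  = cexp (0 -i* (2 * pi * dot y u)) * epstein_zeta (lattice A) nu x y.
Proof.
move=> Aunit Lu Lv; set c := cexp _.
apply: (@epstein_zeta_transport _ _ _ _ _ _ (fun=> c) (fun=> c^-1)
  (fun z => z + u) (fun z => z - u)).
- by move=> b; exact: analytic_cst.
- by move=> b; exact: analytic_cst.
- by move=> _; rewrite divff// cexp_neq0.
- exact: addrK.
- exact: subrK.
- by move=> z [Lz zx]; split; [exact: latticeD|move=> /addIr].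
- move=> z [Lz zx]; split; first by apply: latticeD => //; exact: latticeN.
  by move=> /= zux; apply: zx; rewrite -zux subrK.
- move=> nu' z [Lz _]; have [m vz] := dot_reciprocal_lattice Aunit Lz Lv.
  rewrite /epstein_term opprB addrA mulrA; congr (_ / _).
  (* The shift by [v] contributes the phase of the integer [m], which is 1; it is inserted on the
     right so that only the exponents remain to be compared. *)
  rewrite /c -cexpD dotDl vz mulrDr -[RHS]mulr1 -(cexp_2pi_int R m) -cexpD.
  congr cexp; rewrite dotDr dotNr.
  by apply/eqP; rewrite eq_complex /=; apply/andP; split; apply/eqP; ring.
Qed.

Lemma epstein_zeta_scale (A : 'M[R]_d) x y nu (s : R) : s != 0 ->
  epstein_zeta (lattice A) nu x y = cpow `|s| nu
    * epstein_zeta (scale_set s (lattice A)) nu (s *: x) (s^-1 *: y).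
Proof.
move=> s0; have ns0 : 0 < `|s| by rewrite normr_gt0.
(* The transport goes from the scaled lattice back to the original one, so the multiplier is [cpow]
   of [|s|] itself. *)
apply: (@epstein_zeta_transport _ _ _ _ _ _ (cpow `|s|) (cpow `|s|^-1)
  (fun z => s^-1 *: z) (fun z => s *: z)).
- by move=> c; exact: analytic_cpow.
- by move=> c; exact: analytic_cpow.
- move=> c; rewrite -cpowMl ?invr_gt0// divff ?normr_eq0//.
  by rewrite /cpow ln1 mulr0 cexp0.
- by move=> z; rewrite scalerA divff// scale1r.
- by move=> z; rewrite scalerA mulVf// scale1r.
- move=> _ [[z Lz <-] zx]; rewrite scalerA mulVf// scale1r; split=> //.
  by move=> /= zx'; apply: zx; rewrite /= zx'.
- move=> z [Lz zx]; split; first by exists z.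
  by move=> /= /(scalerI s0).
- move=> nu' z [Lz zx]; rewrite /epstein_term dotZl dotZr mulKf//.
  rewrite -scalerBr enormZ cpowMl//; last first.
    (* Splitting the power of a product takes logarithms of positive numbers; the exclusion of the
       summand [z = x] makes the distance positive. *)
    by apply: enorm_gt0; rewrite subr_eq0; apply/eqP => xz; apply: zx.
  by field; rewrite !cpow_neq0.
Qed.

End EpsteinTransport.

Theorem lemma2p4 (R : realType) (d : nat) (A : 'M[R]_d) (x y : 'cV[R]_d)
    (nu : R[i]) (A_regular : A \in unitmx)
    (nu_regular : reciprocal A y -> nu <> d%:R) :
  [/\ epstein_zeta (lattice A) nu (- x) y = epstein_zeta (lattice A) nu x (- y)
        /\ epstein_zeta (lattice A) nu (- x) (- y)
           = epstein_zeta (lattice A) nu x y,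
      forall u v : 'cV[R]_d, lattice A u -> reciprocal A v ->
        epstein_zeta (lattice A) nu (x + u) (y + v)
        = cexp (0 -i* (2 * pi * dot y u)) * epstein_zeta (lattice A) nu x y
    & forall s : R, s != 0 ->
        epstein_zeta (lattice A) nu x y
        = cpow `|s| nu
          * epstein_zeta (scale_set s (lattice A)) nu (s *: x) (s^-1 *: y)].
Proof.
split.
- by split; [exact: epstein_zeta_opp|rewrite epstein_zeta_opp opprK].
- by move=> u v; exact: epstein_zeta_translate.
- by move=> s; exact: epstein_zeta_scale.
Qed.
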